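(* Let $n\ge1$ and $t\in[0,1]$. The following are equivalent. (i) For all origin-symmetric convex bodies $K,L\subset\mathbb{R}^n$, the Lebesgue measure satisfies $|K^{1-t}L^t|\ \ge\ |K|^{1-t}|L|^t$. (ii) For every triple of integrable functions $f,g,h:\mathbb{R}^n\to[0,\infty)$, with $f,g$ even and unimodal, such that $$h(z)\ \ge\ f(u)^{1-t}g(v)^t\qquad\text{for all } z\in\mathbb{R}^n \text{ and all }(u,v)\in C(z;f,g),$$ where $$C(z;f,g)=\left\{(u,v)\in\mathbb{R}^n\times\mathbb{R}^n:\ z\in\{f\ge f(u)\}^{1-t}\{g\ge g(v)\}^t\right\},$$ one has $$\int_{\mathbb{R}^n}h\ \ge\ \left(\int_{\mathbb{R}^n}f\right)^{1-t}\left(\int_{\mathbb{R}^n}g\right)^t.$$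
   Context: $|\cdot|$ is Lebesgue measure on $\mathbb{R}^n$. A convex body is a compact convex set with non-empty interior. A function $f:\mathbb{R}^n\to\mathbb{R}$ is unimodal if for every $s\in\mathbb{R}$ the set $\{f\ge s\}$ is a convex body whenever it is neither empty nor all of $\mathbb{R}^n$. Even means $f(-x)=f(x)$. The support function of $K$ is $h_K(\theta)=\sup_{x\in K}\langle x,\theta\rangle$. For origin-symmetric convex bodies $K,L$ (which contain the origin in their interiors), the $L_0$-Minkowski (logarithmic) combination is $$K^{1-t}L^t=\bigcap_{\theta\in S^{n-1}}\left\{x\in\mathbb{R}^n:\ \langle x,\theta\rangle\le h_K(\theta)^{1-t}h_L(\theta)^t\right\}.$$ The geometric mean $a^{1-t}b^t$ of $a,b\ge0$ is taken to be $0$ whenever $ab=0$ (for every $t\in[0,1]$); in particular the condition on $h$ is vacuous for pairs $(u,v)$ with $f(u)g(v)=0$, so only superlevel sets that are convex bodies matter. *)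

(* Defs.v *)
From HB Require Import structures.
From mathcomp Require Import all_boot all_order all_algebra.
From mathcomp Require Import all_classical all_reals all_analysis.

Set Implicit Arguments.
Unset Strict Implicit.
Unset Printing Implicit Defensive.

Import Order.TTheory GRing.Theory Num.Theory.
Import numFieldNormedType.Exports.

Local Open Scope classical_set_scope.
Local Open Scope ring_scope.

(* Lebesgue measure on the row vectors R^(n+1): the Caratheodory measure of
   the outer measure given by countable covers by half-open boxes. Its
   sigma-algebra is the complete one, that of all Lebesgue measurable sets. *)
Section lebesgue.
Context {R : realType} {n : nat}.
Local Notation V := 'rV[R]_n.+1.

Definition box (ab : V * V) : set V :=
  [set x : V | forall i, ab.1 0 i < x 0 i <= ab.2 0 i].

(* The maximum with 0 makes a box with an empty side have volume 0. *)
Definition box_volume (ab : V * V) : R :=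
  \prod_(i < n.+1) Num.max 0 (ab.2 0 i - ab.1 0 i).

Definition lebesgue_outer (A : set V) : \bar R :=
  ereal_inf [set (\sum_(k <oo) (box_volume (F k))%:E)%E
            | F in [set F : (V * V)^nat | A `<=` \bigcup_k box (F k)]].

Lemma box_volume_ge0 ab : 0 <= box_volume ab.
Proof. by apply: prodr_ge0 => i _; rewrite le_max lexx. Qed.

Lemma lebesgue_outer_ge0 A : (0 <= lebesgue_outer A)%E.
Proof.
apply: le_ereal_inf_tmp => _ [F _ <-].
by apply: nneseries_ge0 => k _ _; rewrite lee_fin box_volume_ge0.
Qed.

Lemma lebesgue_outer0 : lebesgue_outer set0 = 0%E.
Proof.
apply/eqP; rewrite eq_le lebesgue_outer_ge0 andbT.
apply: ereal_inf_lbound; exists (fun=> (0, 0)); first exact: sub0set.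
apply: eseries0 => k _ _ /=; rewrite /box_volume/= big_ord_recl !mxE subrr.
by rewrite maxxx mul0r.
Qed.

Lemma le_lebesgue_outer :
  {homo lebesgue_outer : A B / A `<=` B >-> (A <= B)%E}.
Proof.
move=> A B AB; apply/ereal_inf_le_tmp => x [F BF <-].
by exists F => //; exact: subset_trans BF.
Qed.

Lemma lebesgue_outer_sigma_subadditive : sigma_subadditive lebesgue_outer.
Proof.
move=> A; have [[i ioo]|] := pselect (exists i, lebesgue_outer (A i) = +oo%E).
  by rewrite (eseries_pinfty _ _ ioo) ?leey// => k _;
    rewrite -ltNye (lt_le_trans _ (lebesgue_outer_ge0 _)).
rewrite -forallNE => Aoo.
apply/lee_addgt0Pr => _/posnumP[e].
rewrite (le_trans _ (epsilon_trick _ _ _))//; last first.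
  by move=> k; exact: lebesgue_outer_ge0.
have [G PG] : {G : ((V * V)^nat)^nat & forall k, A k `<=` \bigcup_j box (G k j) /\
    (\sum_(j <oo) (box_volume (G k j))%:E <=
     lebesgue_outer (A k) + (e%:num / (2 ^ k.+1)%:R)%:E)%E}.
  apply: (@choice _ _ (fun k F => A k `<=` \bigcup_j box (F j) /\
    (\sum_(j <oo) (box_volume (F j))%:E <=
     lebesgue_outer (A k) + (e%:num / (2 ^ k.+1)%:R)%:E)%E)) => k.
  have fin : lebesgue_outer (A k) \is a fin_num.
    rewrite ge0_fin_numE ?lebesgue_outer_ge0// ltey.
    by apply/eqP; exact: Aoo.
  have ek : (0 < e%:num / (2 ^ k.+1)%:R :> R) by [].
  have [_ [F AF <-] /ltW Fe] := lb_ereal_inf_adherent ek fin.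
  by exists F.
pose w (ij : nat * nat) := (box_volume (G ij.1 ij.2))%:E.
have w0 ij : (0 <= w ij)%E by rewrite lee_fin box_volume_ge0.
have /card_esym/ppcard_eqP[h] := card_nat2.
apply: (@le_trans _ _ (\esum_(i in setT) w i)%E).
  apply: ereal_inf_lbound; exists (uncurry G \o h).
    move=> x [i _ /(PG i).1[j _ xij]].
    by exists (h^-1%FUN (i, j)) => //=; rewrite invK ?inE.
  rewrite nneseries_esumT; last by move=> k; rewrite lee_fin box_volume_ge0.
  rewrite (reindex_esum setT setT h)//.
  by apply: eq_esum => k _ /=; rewrite /w; case: (h k).
have -> : (\esum_(i in setT) w i = \sum_(i <oo) \sum_(j <oo) w (i, j))%E.
  rewrite nneseries_esumT; last by move=> i; exact: nneseries_ge0.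
  under [RHS]eq_esum do rewrite nneseries_esumT//.
  rewrite esum_esum// (_ : _ `*`` _ = setT); last by apply/seteqP; split.
  by apply: eq_esum => -[].
apply: lee_nneseries => i *; last exact: (PG i).2.
exact: nneseries_ge0.
Qed.

HB.instance Definition _ := isOuterMeasure.Build R V lebesgue_outer
  lebesgue_outer0 lebesgue_outer_ge0 le_lebesgue_outer
  lebesgue_outer_sigma_subadditive.

Definition lebesgue_rV : set (caratheodory_type lebesgue_outer) -> \bar R :=
  lebesgue_outer.

Let lebesgue_rV_sigma_additive : semi_sigma_additive lebesgue_rV.
Proof. exact: caratheodory_measure_sigma_additive. Qed.

HB.instance Definition _ := isMeasure.Build _ _ _ lebesgue_rV
  lebesgue_outer0 lebesgue_outer_ge0 lebesgue_rV_sigma_additive.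

End lebesgue.
Arguments lebesgue_rV : clear implicits.

(* Both geometric means are 0 as soon as one argument is 0: the convention
   0 `^ 0 = 1 of the library is overridden at t = 0 and t = 1. *)
Definition gmean {R : realType} (t a b : R) : R :=
  if a * b == 0 then 0 else a `^ (1 - t) * b `^ t.

Definition gmeane {R : realType} (t : R) (a b : \bar R) : \bar R :=
  (if a * b == 0 then 0 else a `^ (1 - t)%R * b `^ t)%E.

Section convex_bodies.
Context {R : realType} {n : nat}.
Local Notation V := 'rV[R]_n.+1.
Implicit Types (A K L : set V) (f g : V -> R) (x y z : V).

Definition dotv x y : R := \sum_(i < n.+1) x 0 i * y 0 i.

Definition sphere : set V := [set theta | dotv theta theta = 1].

Definition convex_body A :=
  [/\ compact A, convex_set (A : set (convex_lmodType V)) & A° !=set0].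

Definition origin_symmetric A := forall x, A x -> A (- x).

Definition support_function K (theta : V) : R :=
  sup [set dotv x theta | x in K].

(* K^(1-t) L^t; meaningful for origin-symmetric convex bodies, although defined
   for all sets (sup is 0 on sets that are empty or unbounded above). *)
Definition log_comb (t : R) K L : set V :=
  \bigcap_(theta in sphere)
    [set x | dotv x theta <=
             gmean t (support_function K theta) (support_function L theta)].

Definition superlevel f (s : R) : set V := [set x | s <= f x].

Definition even_fun f := forall x, f (- x) = f x.

Definition unimodal f := forall s : R,
  superlevel f s !=set0 -> superlevel f s <> setT ->
  convex_body (superlevel f s).

(* C(z; f, g). When f and g are integrable, even and unimodal and f u, g v > 0,
   both superlevel sets are origin-symmetric convex bodies; otherwise
   gmean t (f u) (g v) = 0 and the pair imposes nothing on h z >= 0. *)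
Definition Cset (t : R) z f g : set (V * V) :=
  [set uv | log_comb t (superlevel f (f uv.1)) (superlevel g (g uv.2)) z].

Definition integrable_rV f :=
  (lebesgue_rV R n).-integrable setT (EFin \o f).

Definition integral_rV f : \bar R :=
  (\int[lebesgue_rV R n]_x (f x)%:E)%E.

End convex_bodies.

(* Main.v *)
Require Import Defs.
From mathcomp Require Import all_boot all_order all_algebra.
From mathcomp Require Import all_classical all_reals all_analysis.
From mathcomp Require Import measurable_realfun ring lra.

Import Order.TTheory GRing.Theory Num.Theory.
Import numFieldNormedType.Exports.

Local Open Scope classical_set_scope.
Local Open Scope ring_scope.

(** The geometric statement is the case of indicator functions. For f = 1_K and
    g = 1_L the only pairs (u, v) that matter lie in K x L, where the superlevel
    sets are K and L themselves, so that h = 1_(K^(1-t) L^t) is admissible and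
    the functional inequality reads off the geometric one. What has to be
    checked is that these indicators are integrable: closed sets are
    Caratheodory measurable, bounded sets have finite outer measure, and the
    logarithmic combination is closed and bounded.

    Conversely, write Phi(s) = |{f >= s}|, Psi(r) = |{g >= r}| and
    H(w) = |{h >= w}|. If z lies in the logarithmic combination of
    {f >= f u} and {g >= g v}, then h(z) >= f(u)^(1-t) g(v)^t; applied to these
    two convex bodies the geometric inequality gives
    H(s^(1-t) r^t) >= Phi(s)^(1-t) Psi(r)^t whenever s and r are values of f and
    g, and continuity from below of the measure removes that restriction
    ([tail_attained]). It remains to go from the three tails to the three
    integrals, which is a one-dimensional Prekopa-Leindler inequality in
    multiplicative form ([prekopa_leindler_tails]).

    The latter is proved by transport. The integral of f is approximated from
    inside by the area of a staircase below the graph of Phi ([staircase_below_tail]),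
    and similarly for g. Both staircases are cut into vertical strips carrying
    the same fraction of the respective total areas A and B. If a pair of
    corresponding strips has widths d and e and heights a and b, and ends at
    abscissas s' and r', then w = s^(1-t) r^t increases along it by at least
    d^(1-t) e^t, because weighted geometric means are superadditive
    ([geom_superadditive], a two-term Hoelder inequality), while H is at least
    a^(1-t) b^t at the end of the strip. Hence the integral of min(h, w)
    increases by at least (da)^(1-t) (eb)^t, that is by the same fraction of
    A^(1-t) B^t; the sum over all strips is the inequality. The strips
    are produced one at a time by an induction on the two lists of rectangles
    ([transport]). *)

Set Implicit Arguments.
Unset Strict Implicit.
Unset Printing Implicit Defensive.

(** * Weighted geometric means *)

Section geometric_mean.
Context {R : realType}.
Implicit Types (t a b c d x y : R).

(** The plain product of powers, to which the power laws apply without case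
    distinction; it agrees with [gmean] at positive arguments ([gmeanE]). *)
Definition geom t x y := x `^ (1 - t) * y `^ t.

Lemma geom_ge0 t x y : 0 <= geom t x y.
Proof. by rewrite mulr_ge0 ?powR_ge0. Qed.

Lemma geom_gt0 t x y : 0 < x -> 0 < y -> 0 < geom t x y.
Proof. by move=> x0 y0; rewrite mulr_gt0 ?powR_gt0. Qed.

Lemma le_geom t a b x y : 0 <= t <= 1 ->
  0 <= a -> 0 <= b -> a <= x -> b <= y -> geom t a b <= geom t x y.
Proof.
move=> /andP[t0 t1] a0 b0 ax byy; apply: ler_pM; rewrite ?powR_ge0//.
- by apply: ge0_ler_powR; rewrite ?subr_ge0// nnegrE// (le_trans a0).
- by apply: ge0_ler_powR => //; rewrite nnegrE// (le_trans b0).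
Qed.

Lemma geomM t a b x y : 0 <= a -> 0 <= b -> 0 <= x -> 0 <= y ->
  geom t a b * geom t x y = geom t (a * x) (b * y).
Proof. by move=> *; rewrite /geom !powRM// mulrACA. Qed.

Lemma geomZ t c x y : 0 < c -> 0 <= x -> 0 <= y ->
  geom t (c * x) (c * y) = c * geom t x y.
Proof.
move=> c0 x0 y0; have c0w := ltW c0.
have cc : geom t c c = c; last by rewrite -[in RHS]cc geomM.
rewrite /geom -powRD; last by rewrite (gt_eqF c0) implybT.
by rewrite subrK powRr1// ltW.
Qed.

(** For 0 < t < 1 this is Hoelder's inequality with exponents 1/(1-t) and 1/t
    for two summands; at t = 0 and t = 1 it is an equality. *)
Lemma geom_superadditive t a b c d : 0 <= t <= 1 ->
  0 <= a -> 0 <= b -> 0 <= c -> 0 <= d ->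
  geom t a b + geom t c d <= geom t (a + c) (b + d).
Proof.
move=> /andP[t0 t1] a0 b0 c0 d0; rewrite /geom.
have [->|tn0] := eqVneq t 0.
  by rewrite subr0 !powRr1 ?addr_ge0// !powRr0 !mulr1.
have [->|tn1] := eqVneq t 1.
  by rewrite subrr !powRr1 ?addr_ge0// !powRr0 !mul1r.
have tp : 0 < t by rewrite lt_neqAle eq_sym tn0.
have tp1 : 0 < 1 - t by rewrite subr_gt0 lt_neqAle tn1.
have := @hoelder2 R (a `^ (1 - t)) (c `^ (1 - t)) (b `^ t) (d `^ t)
   (1 - t)^-1 t^-1.
rewrite !invrK -!powRrM !divff ?gt_eqF// !powRr1//.
by apply; rewrite ?powR_ge0 ?invr_gt0// subrK.
Qed.

End geometric_mean.

(** * Discrete transport along two staircases *)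

Section transport.
Context {R : realType}.
Implicit Types (P Q : seq (R * R)) (Phi Psi J : R -> R).

(** A staircase is a list of adjacent rectangles (width, height). *)
Definition area P : R := \sum_(p <- P) p.1 * p.2.

(** The staircase P, placed from abscissa s on, lies under the graph of a
    nonincreasing Phi: comparing heights with Phi at right endpoints suffices.
    Degenerate rectangles are exempt, so that Phi need only be meaningful on
    positive reals even though the staircase may start at 0. *)
Fixpoint below Phi (s : R) P : Prop :=
  if P is (d, a) :: P' then
    [/\ 0 <= d, 0 <= a, 0 < d -> a <= Phi (s + d) & below Phi (s + d) P']
  else True.

Lemma cut_width (e b p q B : R) : 0 <= e -> 0 <= p -> p <= q ->
  e * b = q * B -> exists e', [/\ 0 <= e', e' <= e & e' * b = p * B].
Proof.
move=> e0 p0 pq ebE; have [q00|qn0] := eqVneq q 0.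
  have -> : p = 0 by apply/le_anti; rewrite p0 andbT -q00.
  by exists 0; rewrite !mul0r.
have qp : 0 < q by rewrite lt_neqAle eq_sym qn0 (le_trans p0 pq).
exists (e * (p / q)); split.
- by apply: mulr_ge0 => //; apply: divr_ge0 => //; exact: ltW.
- by rewrite ler_piMr// ler_pdivrMr// mul1r.
- by rewrite mulrAC ebE; field.
Qed.

(** J plays the part of w |-> integral of min(h, w), bounded by the full
    integral I. The constants A and B are kept fixed in the induction while the
    remaining staircases shrink, the hypothesis being that they carry the same
    fraction of A and of B; at each step the head rectangle with the smaller
    fraction disappears and the other head is shortened, so that the total
    number of rectangles decreases. *)
Lemma transport (t : R) Phi Psi J (I A B : R) : 0 <= t <= 1 ->
  {in Num.pos &, {homo Phi : x y /~ x <= y}} ->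
  {in Num.pos &, {homo Psi : x y /~ x <= y}} ->
  {homo J : x y / x <= y} -> (forall w, J w <= I) ->
  (forall s r w : R, 0 < s -> 0 < r -> 0 < Phi s -> 0 < Psi r ->
    0 <= w -> w <= geom t s r ->
    J w + (geom t s r - w) * geom t (Phi s) (Psi r) <= J (geom t s r)) ->
  0 < A -> 0 < B ->
  forall P Q (s r : R), 0 <= s -> 0 <= r -> below Phi s P -> below Psi r Q ->
    area P / A = area Q / B ->
    J (geom t s r) + area P / A * geom t A B <= I.
Proof.
move=> t01 dPhi dPsi ndJ JI HJ A0 B0.
(* One pair of strips carrying the fraction m of A and of B. *)
have gain (s r d e a b m : R) : 0 <= s -> 0 <= r -> 0 <= d -> 0 <= e ->
    0 <= a -> (0 < d -> a <= Phi (s + d)) ->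
    0 <= b -> (0 < e -> b <= Psi (r + e)) ->
    d * a = m * A -> e * b = m * B -> 0 <= m ->
    J (geom t s r) + m * geom t A B <= J (geom t (s + d) (r + e)).
  move=> s0 r0 d0 e0 a0 aP b0 bP da eb m0.
  have ww : geom t s r <= geom t (s + d) (r + e).
    by apply: le_geom => //; rewrite lerDl.
  move: m0; rewrite le_eqVlt => /predU1P[m0|m0].
    by rewrite -m0 mul0r addr0 ndJ.
  have : 0 < d * a by rewrite da mulr_gt0.
  have : 0 < e * b by rewrite eb mulr_gt0.
  move=> eb0 da0.
  have dp : 0 < d.
    by rewrite lt_neqAle d0 andbT; apply: contraTneq da0 => <-; rewrite mul0r ltxx.
  have ep : 0 < e.
    by rewrite lt_neqAle e0 andbT; apply: contraTneq eb0 => <-; rewrite mul0r ltxx.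
  have ap : 0 < a by rewrite -(pmulr_rgt0 _ dp).
  have bp : 0 < b by rewrite -(pmulr_rgt0 _ ep).
  apply: le_trans (HJ (s + d) (r + e) (geom t s r) _ _ _ _ (geom_ge0 _ _ _) ww);
    [|by rewrite ltr_wpDl..|by rewrite (lt_le_trans ap) ?aP|
     by rewrite (lt_le_trans bp) ?bP].
  rewrite lerD2l -(geomZ _ m0 (ltW A0) (ltW B0)) -da -eb -geomM//.
  apply: ler_pM; rewrite ?geom_ge0//.
    by rewrite lerBrDl geom_superadditive.
  by rewrite le_geom// ?aP ?bP.
move=> P Q; have [n] := ubnP (size P + size Q); elim: n P Q => // n IH P Q.
have nil_case (s r : R) : J (geom t s r) + 0 / A * geom t A B <= I.
  by rewrite !mul0r addr0.
case: P => [|[d a] P]; first by move=> *; rewrite /area big_nil.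
case: Q => [|[e b] Q].
  by move=> _ s r s0 r0 _ _ ->; rewrite {1}/area big_nil !mul0r addr0.
rewrite /= ltnS addnS addSn => sz s r s0 r0 [d0 a0 aP HP] [e0 b0 bP HQ].
rewrite /area !big_cons /= -!/(area _) => PQ.
pose p := d * a / A; pose q := e * b / B.
have p0 : 0 <= p by rewrite divr_ge0 ?mulr_ge0// ltW.
have q0 : 0 <= q by rewrite divr_ge0 ?mulr_ge0// ltW.
have daE : d * a = p * A by rewrite /p divfK// gt_eqF.
have ebE : e * b = q * B by rewrite /q divfK// gt_eqF.
have [pq|/ltW qp] := leP p q.
- (* The head of P carries the smaller fraction p of its area: it is matched
     with a strip of width e' cut off the head of Q. *)
  have [e' [e'0 e'e e'b]] := cut_width e0 p0 pq ebE.
  have step : J (geom t s r) + p * geom t A B <= J (geom t (s + d) (r + e')).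
    apply: (gain _ _ _ _ a b) => // e'p.
    apply: le_trans (bP (lt_le_trans e'p e'e)) _.
    have ep := lt_le_trans e'p e'e.
    by apply: dPsi; rewrite ?lerD2l// posrE ltr_wpDl.
  have := IH P ((e - e', b) :: Q) _ (s + d) (r + e').
  rewrite /= addnS => /(_ sz (addr_ge0 s0 d0) (addr_ge0 r0 e'0) HP).
  have bP' : 0 < e - e' -> b <= Psi (r + e).
    by rewrite subr_gt0 => /(le_lt_trans e'0)/bP.
  have -> : r + e' + (e - e') = r + e by ring.
  rewrite subr_ge0 => /(_ (And4 e'e b0 bP' HQ)).
  rewrite /area !big_cons /= -!/(area _) mulrBl ebE e'b.
  have -> : area P / A = (q * B - p * B + area Q) / B.
    apply: (addrI (d * a / A)); rewrite -mulrDl PQ ebE daE; field.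
    by rewrite !gt_eqF.
  move=> /(_ erefl); apply: le_trans.
  have -> : (d * a + area P) / A = p + (q * B - p * B + area Q) / B.
    rewrite PQ ebE; field; by rewrite gt_eqF.
  by rewrite mulrDl addrA lerD2r.
- (* Symmetric situation: the whole head of Q is used up. *)
  have [d' [d'0 d'd d'a]] := cut_width d0 q0 qp daE.
  have step : J (geom t s r) + q * geom t A B <= J (geom t (s + d') (r + e)).
    apply: (gain _ _ _ _ a b) => // d'p.
    apply: le_trans (aP (lt_le_trans d'p d'd)) _.
    have dp := lt_le_trans d'p d'd.
    by apply: dPhi; rewrite ?lerD2l// posrE ltr_wpDl.
  have := IH ((d - d', a) :: P) Q _ (s + d') (r + e).
  rewrite /= addSn => /(_ sz (addr_ge0 s0 d'0) (addr_ge0 r0 e0)).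
  have aP' : 0 < d - d' -> a <= Phi (s + d).
    by rewrite subr_gt0 => /(le_lt_trans d'0)/aP.
  have -> : s + d' + (d - d') = s + d by ring.
  rewrite subr_ge0 => /(_ (And4 d'd a0 aP' HP) HQ).
  rewrite /area !big_cons /= -!/(area _) mulrBl daE d'a.
  have -> : (p * A - q * A + area P) / A = area Q / B.
    apply: (addrI (e * b / B)); rewrite -[RHS]mulrDl -PQ ebE daE; field.
    by rewrite !gt_eqF.
  move=> /(_ erefl); apply: le_trans.
  have -> : (p * A + area P) / A = q + area Q / B.
    rewrite -daE PQ ebE; field; by rewrite gt_eqF.
  by rewrite mulrDl addrA lerD2r.
Qed.

End transport.

(** * Tails of integrable functions *)

Lemma le_of_scaled (R : realFieldType) (x y : R) : 0 < x ->
  (forall c, 0 < c < 1 -> c * x <= y) -> x <= y.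
Proof.
move=> x0 cxy; rewrite leNgt; apply/negP => yx.
have y0 : 0 < y.
  apply: lt_le_trans (cxy 2^-1 _); first by rewrite mulr_gt0.
  by apply/andP; split; lra.
have := cxy ((y + x) / 2 / x).
rewrite divfK ?gt_eqF// divr_gt0//= ?divr_gt0//= ?addr_gt0//.
by rewrite ltr_pdivrMr// mul1r => /(_ ltac:(lra)); lra.
Qed.

Section tails.
Context d {T : measurableType d} {R : realType}.
Variable mu : {measure set T -> \bar R}.
Implicit Types (f h : T -> R) (s v w : R).

Definition tail f s : R := fine (mu [set x | s <= f x]).

Lemma tail_ge0 f s : 0 <= tail f s.
Proof. exact: fine_ge0. Qed.

Lemma measurable_upper f s : measurable_fun setT f ->
  measurable [set x | s <= f x].
Proof.
move=> mf; rewrite (_ : [set x | _] = setT `&` f @^-1` `[s, +oo[); first exact: mf.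
by apply/seteqP; split => x /=; rewrite in_itv/= andbT => // -[].
Qed.

Lemma indic_upper f s :
  (fun x => (s <= f x)%R%:R) = \1_[set x | s <= f x] :> (T -> R).
Proof.
by apply/funext => x; rewrite indicE; congr (_%:R); congr nat_of_bool;
  apply/idP/idP; rewrite inE.
Qed.

Section integrable_function.
Import HBNNSimple.
Variable f : T -> R.
Hypothesis f0 : forall x, 0 <= f x.
Hypothesis intf : mu.-integrable setT (EFin \o f).

Let mf : measurable_fun setT f.
Proof. by apply/measurable_EFinP; exact: measurable_int intf. Qed.

Let iE : (\int[mu]_x (f x)%:E = (fine (\int[mu]_x (f x)%:E))%:E)%E.
Proof. by rewrite fineK//; exact: integrable_fin_num. Qed.

(** Markov's inequality; it makes every tail at a positive level finite, which
    is what allows tails to be handled as real numbers. *)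
Lemma markov_tail s : 0 < s ->
  (s%:E * mu [set x | (s <= f x)%R] <= \int[mu]_x (f x)%:E)%E.
Proof.
move=> s0; have mS := measurable_upper s mf.
rewrite -[X in mu X]setIT -integral_indic// -ge0_integralZl//=; last 2 first.
- exact/measurable_EFinP.
- by rewrite lee_fin ltW.
apply: ge0_le_integral => //=.
- by move=> x _; rewrite -EFinM lee_fin mulr_ge0// ltW.
- apply/measurable_EFinP/measurable_funM => //.
- exact/measurable_EFinP.
- move=> x _; rewrite -EFinM lee_fin indicE.
  have [|_] := boolP (x \in _); last by rewrite mulr0.
  by rewrite inE mulr1.
Qed.

Lemma upper_fin s : 0 < s -> mu [set x | s <= f x] \is a fin_num.
Proof.
move=> s0; rewrite ge0_fin_numE//; have := markov_tail s0.
rewrite iE; case: (mu _) (measure_ge0 mu [set x | s <= f x]) => [r|_|//] //.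
  by rewrite ltry.
by rewrite gt0_muley ?lte_fin.
Qed.

Lemma tailE s : 0 < s -> mu [set x | s <= f x] = (tail f s)%:E.
Proof. by move=> s0; rewrite fineK// upper_fin. Qed.

Lemma tail_anti : {in Num.pos &, {homo tail f : x y /~ x <= y}}.
Proof.
move=> x y; rewrite !posrE => x0 y0 yx; rewrite /tail fine_le ?upper_fin//.
apply: le_measure; rewrite ?inE; [exact: measurable_upper..|].
by move=> z /=; exact: le_trans.
Qed.

(** Let m be the infimum of the values of f on {f >= s}. If m is attained at u,
    then {f >= s} = {f >= f u}. Otherwise {f >= s} is the increasing union of the
    sets {f >= m + 1/(k+1)}, one of which has measure above a; a point u
    of {f >= s} with f u < m + 1/(k+1) has a still larger superlevel set. *)
Lemma tail_attained s a : 0 < s -> 0 <= a < tail f s ->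
  exists2 u, s <= f u & a < tail f (f u).
Proof.
move=> s0 /andP[a0 as_]; pose S := [set x | s <= f x].
have [x0 Sx0] : S !=set0.
  apply/set0P; apply: contraTneq as_ => S0.
  by rewrite /tail -/S S0 measure0 -leNgt.
have lbS : lbound (f @` S) s by move=> _ [x Sx <-].
have infS : has_inf (f @` S) by split; [exists (f x0), x0|exists s].
pose m := inf (f @` S).
have sm : s <= m by apply: lb_le_inf => //; exact: infS.1.
have mS x : S x -> m <= f x by move=> Sx; apply: ge_inf; [exists s|exists x].
have [[u Su fu]|noatt] := pselect (exists2 u, S u & f u = m).
  exists u => //; rewrite (_ : tail f (f u) = tail f s)//.
  rewrite /tail; congr (fine (mu _)); apply/seteqP; split=> x /= xu.
    exact: le_trans Su xu.
  by rewrite fu; exact: mS.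
pose F k := [set x | m + k.+1%:R^-1 <= f x].
have e0 k : 0 < k.+1%:R^-1 :> R by rewrite invr_gt0.
have mk0 k : 0 < m + k.+1%:R^-1 by rewrite addr_gt0// (lt_le_trans s0).
have [k aF] : exists k, a < tail f (m + k.+1%:R^-1).
  apply: contrapT => /forallNP aF.
  suff : (mu S <= a%:E)%E by rewrite tailE// lee_fin leNgt as_.
  have mF k : measurable (F k) by exact: measurable_upper.
  have SF : S = \bigcup_k F k.
    apply/seteqP; split=> x.
      move=> Sx; have mx : 0 < f x - m.
        rewrite subr_gt0 lt_neqAle mS// andbT; apply/negP => /eqP mx.
        by apply: noatt; exists x.
      exists (Num.truncn (f x - m)^-1) => //=; rewrite /F/= -lerBrDl.
      rewrite -[leRHS]invrK lef_pV2 ?posrE ?invr_gt0//.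
      exact/ltW/truncnS_gt.
    move=> [k _ /= xk]; rewrite /S/=; apply: le_trans xk.
    by rewrite (le_trans sm)// lerDl ltW.
  have ndF : nondecreasing_seq F.
    move=> i j ij; apply/subsetPset => x /=; apply: le_trans.
    by rewrite lerD2l lef_pV2 ?posrE// ler_nat.
  have cF := @nondecreasing_cvg_mu _ _ _ mu _ mF (bigcupT_measurable F mF) ndF.
  rewrite SF -(cvg_lim _ cF)//; apply: lime_le; first by apply/cvg_ex; eexists; exact: cF.
  apply: nearW => k /=; rewrite tailE// lee_fin leNgt; apply/negP.
  exact: aF.
have [_ [u Su <-] uk] := inf_adherent (e0 k) infS.
exists u => //; apply: (lt_le_trans aF); apply: tail_anti; rewrite ?posrE//.
  exact: lt_le_trans Su.
exact: ltW.
Qed.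

(** The staircase whose steps end at the levels vs, and the layer-cake sum whose
    integral is its area. *)
Fixpoint layers s (vs : seq R) : seq (R * R) :=
  if vs is v :: vs' then (v - s, tail f v) :: layers v vs' else [::].

Fixpoint layer_sum s (vs : seq R) (y : R) : R :=
  if vs is v :: vs' then (v - s) * (v <= y)%R%:R + layer_sum v vs' y else 0.

Lemma below_layers s vs : path <=%R s vs -> below (tail f) s (layers s vs).
Proof.
elim: vs s => //= v vs IH s /andP[sv /IH pv].
by rewrite subr_ge0 subrKC; split => //; exact: tail_ge0.
Qed.

Lemma layer_sum_ge0 s vs y : path <=%R s vs -> 0 <= layer_sum s vs y.
Proof.
elim: vs s => //= v vs IH s /andP[sv /IH ?].
by rewrite addr_ge0// mulr_ge0// subr_ge0.
Qed.

Lemma layer_sumP s vs x y : path <=%R s vs -> x \in s :: vs -> x <= y ->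
  x - s <= layer_sum s vs y.
Proof.
elim: vs s => [|v vs IH] s /=; first by rewrite inE => _ /eqP ->; rewrite subrr.
move=> /andP[sv pv]; rewrite inE => /predU1P[-> _|xv xy].
  by rewrite subrr addr_ge0 ?layer_sum_ge0// mulr_ge0// subr_ge0.
have vx : v <= x.
  move: xv; rewrite inE => /predU1P[->//|xv].
  by have /allP := order_path_min le_trans pv; apply.
by rewrite (le_trans vx xy) mulr1; have := IH _ pv xv xy; lra.
Qed.

Lemma measurable_layer_sum s vs :
  measurable_fun setT (fun x => layer_sum s vs (f x)).
Proof.
elim: vs s => [|v vs IH] s /=; first exact: measurable_cst.
apply: measurable_funD => //; apply: measurable_funM => //.
by rewrite indic_upper; exact/measurable_indic/measurable_upper.
Qed.

Lemma integral_layer_sum s vs : 0 <= s -> path <=%R s vs ->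
  (\int[mu]_x (layer_sum s vs (f x))%:E = (area (layers s vs))%:E)%E.
Proof.
rewrite /area; elim: vs s => [|v vs IH] s s0 /=.
  by move=> _; rewrite big_nil integral0_eq.
move=> /andP[sv pv]; have v0 := le_trans s0 sv; have vs0 : 0 <= v - s by rewrite subr_ge0.
have mS := measurable_upper v mf.
have Ex x := congr1 (@^~ x) (indic_upper f v).
under eq_integral do rewrite EFinD EFinM Ex.
rewrite ge0_integralD//=; last 4 first.
- by move=> x _; rewrite -EFinM lee_fin mulr_ge0.
- apply/measurable_EFinP/measurable_funM => //.
- by move=> x _; rewrite lee_fin layer_sum_ge0.
- exact/measurable_EFinP/measurable_layer_sum.
rewrite ge0_integralZl//=; last exact/measurable_EFinP.
rewrite integral_indic// setIT big_cons /= IH// [RHS]EFinD EFinM; congr (_ + _)%E.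
(* At level 0 the superlevel set may have infinite measure, but then the
   layer has width 0. *)
move: v0; rewrite le_eqVlt => /predU1P[v00|vp]; last by rewrite tailE.
suff -> : v - s = 0 by rewrite !mul0e.
by apply/le_anti; rewrite vs0 andbT -v00 subr_le0.
Qed.

(** The integral is a supremum over simple functions phi <= f. The layers at the
    finitely many values of phi have at least the area of phi, since
    {phi >= v} is contained in {f >= v}. *)
Lemma staircase_below_tail (c : R) : (c%:E < \int[mu]_x (f x)%:E)%E ->
  exists2 P, below (tail f) 0 P & c <= area P.
Proof.
rewrite ge0_integralTE//.
move=> /ereal_sup_gt[_ [/= phi phif <-]] cphi.
have /finite_seqP[us rangeE] : finite_set (range phi) by [].
pose vs := sort <=%R us.
have memvs x : phi x \in vs.
  by rewrite mem_sort; have : [set` us] (phi x) by rewrite -rangeE; exists x.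
have pvs : path <=%R 0 vs.
  rewrite path_min_sorted ?sort_le_sorted//.
  apply/allP => v; rewrite mem_sort => vus.
  have : [set` us] v by [].
  by rewrite -rangeE => -[x _ <-].
exists (layers 0 vs); first exact: below_layers.
rewrite -lee_fin; apply: (le_trans (ltW cphi)).
rewrite -integral_layer_sum//.
have <- : (\int[mu]_x (phi x)%:E = sintegral mu phi)%E.
  by rewrite integral_nnsfun// patch_setT.
apply: ge0_le_integral => //=.
- by move=> x _; rewrite lee_fin.
- exact/measurable_EFinP.
- exact/measurable_EFinP/measurable_layer_sum.
- move=> x _; rewrite lee_fin -[leLHS]subr0 layer_sumP//.
    by rewrite inE memvs orbT.
  by rewrite -lee_fin phif.
Qed.

(** The maximum with 0 only makes this nondecreasing and nonnegative on the whole
    line; levels w are nonnegative in use. *)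
Definition trunc_integral w : R :=
  fine (\int[mu]_x (Num.min (f x) (Num.max 0 w))%:E).

Let mmin w : measurable_fun setT (EFin \o (fun x => Num.min (f x) (Num.max 0 w))).
Proof. by apply/measurable_EFinP; apply: measurable_minr. Qed.

Let min0 w x : 0 <= Num.min (f x) (Num.max 0 w).
Proof. by rewrite le_min f0 le_max lexx. Qed.

Let tiE w : (\int[mu]_x (Num.min (f x) (Num.max 0 w))%:E = (trunc_integral w)%:E)%E.
Proof.
rewrite fineK// ge0_fin_numE; last by apply: integral_ge0 => x _; rewrite lee_fin.
apply: (@le_lt_trans _ _ (\int[mu]_x (f x)%:E)%E); last by rewrite iE ltry.
apply: ge0_le_integral => //=.
- by move=> x _; rewrite lee_fin.
- exact: mmin.
- exact/measurable_EFinP.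
- by move=> x _; rewrite lee_fin ge_min lexx.
Qed.

Lemma trunc_integral_ge0 w : 0 <= trunc_integral w.
Proof. by rewrite fine_ge0// integral_ge0// => x _; rewrite lee_fin. Qed.

Lemma trunc_integral_homo : {homo trunc_integral : x y / x <= y}.
Proof.
move=> x y xy; rewrite -lee_fin -!tiE; apply: ge0_le_integral => //=.
- by move=> z _; rewrite lee_fin.
- exact: mmin.
- exact: mmin.
- move=> z _; rewrite lee_fin le_min !ge_min lexx/=; apply/orP; right.
  by rewrite ge_max !le_max lexx xy orbT.
Qed.

Lemma trunc_integral_le w : trunc_integral w <= fine (\int[mu]_x (f x)%:E).
Proof.
rewrite -lee_fin -iE -tiE; apply: ge0_le_integral => //=.
- by move=> x _; rewrite lee_fin.
- exact: mmin.
- exact/measurable_EFinP.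
- by move=> x _; rewrite lee_fin ge_min lexx.
Qed.

(** Pointwise, min(f, w) + (v - w) 1_{f >= v} <= min(f, v). *)
Lemma trunc_integral_step w v : 0 <= w -> w <= v -> 0 < v ->
  trunc_integral w + (v - w) * tail f v <= trunc_integral v.
Proof.
move=> w0 wv v0; have mS := measurable_upper v mf.
have vw0 : 0 <= v - w by rewrite subr_ge0.
rewrite -lee_fin EFinD EFinM -tailE// -!tiE.
rewrite -[X in mu X]setIT -integral_indic// -ge0_integralZl//=; last first.
  exact/measurable_EFinP.
rewrite -ge0_integralD//=; last 4 first.
- by move=> x _; rewrite lee_fin.
- exact: mmin.
- by move=> x _; rewrite -EFinM lee_fin mulr_ge0.
- exact/measurable_EFinP/measurable_funM.
apply: ge0_le_integral => //=.
- by move=> x _; rewrite -EFinM -EFinD lee_fin addr_ge0 ?mulr_ge0.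
- apply/measurable_EFinP/measurable_funD; first exact/measurable_EFinP/mmin.
  exact/measurable_funM.
- exact: mmin.
- move=> x _; rewrite -EFinM -EFinD lee_fin indicE.
  rewrite (max_r w0) (max_r (ltW v0)).
  have [|_] := boolP (x \in _).
    rewrite inE /= mulr1 => vf; rewrite (min_r vf) (min_r (le_trans wv vf)).
    by rewrite addrC subrK.
  by rewrite mulr0 addr0 le_min !ge_min lexx wv orbT.
Qed.

End integrable_function.
End tails.

(** Staircases of areas P >= cF and Q >= cG, where c < 1 and F and G are the
    integrals of f and g, are transported along each other completely, so the
    integral of h is at least P^(1-t) Q^t >= c F^(1-t) G^t; let c tend to 1. *)
Lemma prekopa_leindler_tails d (T : measurableType d) (R : realType)
  (mu : {measure set T -> \bar R}) (t : R) (f g h : T -> R) : 0 <= t <= 1 ->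
  (forall x, 0 <= f x) -> (forall x, 0 <= g x) -> (forall x, 0 <= h x) ->
  mu.-integrable setT (EFin \o f) -> mu.-integrable setT (EFin \o g) ->
  mu.-integrable setT (EFin \o h) ->
  (forall s r : R, 0 < s -> 0 < r -> 0 < tail mu f s -> 0 < tail mu g r ->
    geom t (tail mu f s) (tail mu g r) <= tail mu h (geom t s r)) ->
  (0 < \int[mu]_x (f x)%:E)%E -> (0 < \int[mu]_x (g x)%:E)%E ->
  geom t (fine (\int[mu]_x (f x)%:E)) (fine (\int[mu]_x (g x)%:E)) <=
  fine (\int[mu]_x (h x)%:E).
Proof.
move=> t01 f0 g0 h0 If Ig Ih tails.
set F := fine _; set G := fine _; set H := fine _.
have FE : (\int[mu]_x (f x)%:E = F%:E)%E by rewrite fineK//; exact: integrable_fin_num.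
have GE : (\int[mu]_x (g x)%:E = G%:E)%E by rewrite fineK//; exact: integrable_fin_num.
rewrite FE GE !lte_fin => Fp Gp.
apply: le_of_scaled => [|c /andP[c0 c1]]; first exact: geom_gt0.
have [|P bP cP] := @staircase_below_tail _ _ _ mu f f0 If (c * F).
  by rewrite FE lte_fin gtr_pMl.
have [|Q bQ cQ] := @staircase_below_tail _ _ _ mu g g0 Ig (c * G).
  by rewrite GE lte_fin gtr_pMl.
have Pp : 0 < area P by rewrite (lt_le_trans _ cP)// mulr_gt0.
have Qp : 0 < area Q by rewrite (lt_le_trans _ cQ)// mulr_gt0.
have := @transport R t (tail mu f) (tail mu g) (trunc_integral mu h) H
  (area P) (area Q) t01 (tail_anti f0 If) (tail_anti g0 Ig)
  (trunc_integral_homo h0 Ih) (trunc_integral_le h0 Ih) _ Pp Qp P Q 0 0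
  (lexx _) (lexx _) bP bQ.
rewrite !divff ?gt_eqF// mul1r => step.
apply: (@le_trans _ _ (trunc_integral mu h (geom t 0 0) +
  geom t (area P) (area Q))); last first.
  apply: step => // s r w s0 r0 fs gr w0 w1.
  apply: le_trans (trunc_integral_step h0 Ih w0 w1 (geom_gt0 t s0 r0)).
  by rewrite lerD2l ler_wpM2l ?subr_ge0//; exact: tails.
apply: (@le_trans _ _ (geom t (area P) (area Q))).
  rewrite -(geomZ _ c0 (ltW Fp) (ltW Gp)).
  by apply: le_geom => //; apply/ltW/mulr_gt0.
by rewrite lerDr trunc_integral_ge0.
Qed.

(** * Lebesgue measurable sets *)

Section lebesgue_sets.
Context {R : realType} {n : nat}.
Local Notation V := 'rV[R]_n.+1.
Local Notation outer := (@lebesgue_outer R n).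
Local Notation VL := (caratheodory_type outer).
Implicit Types (A K U : set V) (ab : V * V) (i : 'I_n.+1) (c : R).

Lemma lebesgue_outer_cover A (F : (V * V)^nat) : A `<=` \bigcup_k box (F k) ->
  (outer A <= \sum_(k <oo) (box_volume (F k))%:E)%E.
Proof. by move=> AF; apply: ereal_inf_lbound; exists F. Qed.

(** Dilation by 2 maps the whole space to itself and multiplies volumes of boxes
    by 2^(n+1), so the total measure c satisfies 2^(n+1) c <= c. This dichotomy
    is enough to exclude a superlevel set equal to the whole space: its measure
    would be positive and finite. *)
Lemma lebesgue_outerT : outer setT = 0%E \/ outer setT = +oo%E.
Proof.
pose k : R := 2 ^+ n.+1.
have k1 : 1 < k by rewrite exprn_egt1// ltr1n.
have k0 : 0 < k by rewrite (lt_trans _ k1).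
have kT : (k%:E * outer setT <= outer setT)%E.
  apply: le_ereal_inf_tmp => _ [F TF <-] /=.
  pose G j := (2^-1 *: (F j).1, 2^-1 *: (F j).2).
  have volG j : box_volume (F j) = k * box_volume (G j).
    rewrite /box_volume /k -[n.+1 in X in X * _]card_ord -prodr_const -big_split.
    apply: eq_bigr => i _ /=; rewrite !mxE maxr_pMr// mulr0; congr Num.max; by field.
  under eq_eseriesr do rewrite volG EFinM.
  rewrite nneseriesZl; last by move=> j _; rewrite lee_fin box_volume_ge0.
  rewrite lee_pmul2l//; apply: lebesgue_outer_cover => x _.
  have [j _ /= xj] := TF (2 *: x) Logic.I.
  exists j => // i; have := xj i; rewrite !mxE /=.
  by rewrite ![2^-1 * _]mulrC ltr_pdivrMr// ler_pdivlMr// ![_ * 2]mulrC.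
move: kT (lebesgue_outer_ge0 (n := n) (R := R) setT).
case: (outer setT) => [r|_ _|//]; last by right.
rewrite -EFinM !lee_fin => kr r0; left; congr (_%:E); apply/le_anti.
rewrite r0 andbT -(@pmulr_rle0 _ (k - 1)) ?subr_gt0//.
by rewrite mulrBl mul1r subr_le0.
Qed.

Definition cut_below i c ab : V * V :=
  (ab.1, \row_j if j == i then Num.min (ab.2 0 j) c else ab.2 0 j).

Definition cut_above i c ab : V * V :=
  (\row_j (if j == i then Num.max (ab.1 0 j) c else ab.1 0 j), ab.2).

Lemma box_volume_cut i c ab :
  box_volume (cut_below i c ab) + box_volume (cut_above i c ab) = box_volume ab.
Proof.
rewrite /box_volume.
rewrite (bigD1 i)// [in X in _ + X](bigD1 i)// [in RHS](bigD1 i)//=.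
rewrite !mxE eqxx.
under eq_bigr => j /negbTE ji do rewrite mxE ji.
under [X in _ + _ * X]eq_bigr => j /negbTE ji do rewrite mxE ji.
rewrite -mulrDl; congr (_ * _).
move: (ab.1 0 i) (ab.2 0 i) => a b.
rewrite /Order.max /Order.min.
by do ! case: ifPn; rewrite -?leNgt; lra.
Qed.

(** Cutting every box of a cover of X along the hyperplane x_i = c yields covers
    of both parts of X without changing the total volume. *)
Lemma halfspace_measurable i c :
  measurable ([set x : V | x 0 i <= c] : set VL).
Proof.
apply: le_caratheodory_measurable => X; apply: le_ereal_inf_tmp => _ [F XF <-] /=.
under eq_eseriesr do rewrite -(box_volume_cut i c) EFinD.
rewrite nneseriesD; [|by move=> k _ _; rewrite lee_fin box_volume_ge0..].
apply: leeD; apply: lebesgue_outer_cover => x [/XF[k _ /= xk] /= xc];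
  exists k => // j; have /andP[aj bj] := xk j; rewrite /= mxE.
  by case: eqP => [->|_] in aj bj *; rewrite ?le_min aj bj ?xc.
move/negP: xc; rewrite -ltNge => xc.
by case: eqP => [->|_] in aj bj *; rewrite ?gt_max aj bj ?xc.
Qed.

Lemma box_measurable ab : measurable (box ab : set VL).
Proof.
pose S i := [set x : V | x 0 i <= ab.2 0 i] `\` [set x : V | x 0 i <= ab.1 0 i].
have -> : box ab = ~` \bigcup_i ~` S i.
  rewrite setC_bigcup; apply/seteqP; split => [x xab i _|x xS i].
    rewrite setCK; have /andP[x1 x2] := xab i; split => //=.
    by apply/negP; rewrite -ltNge.
  have := xS i Logic.I; rewrite setCK => -[/= x2 /negP].
  by rewrite -ltNge => ->.
apply: measurableC; apply: countable_bigcupT_measurable => // i.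
by apply/measurableC/measurableD; exact: halfspace_measurable.
Qed.

(** An open set is the union of the countably many boxes with rational corners
    that it contains. *)
Lemma open_lebesgue_measurable U : open U -> measurable (U : set VL).
Proof.
move=> oU.
pose rbox (pq : 'rV[rat]_n.+1 * 'rV[rat]_n.+1) :=
  box (map_mx ratr pq.1 : V, map_mx ratr pq.2 : V).
have -> : U = \bigcup_pq (if pselect (rbox pq `<=` U) then rbox pq else set0).
  apply/seteqP; split => [x Ux|x [pq _]]; last by case: pselect => // s /s.
  have /nbhs_ballP[e /= e0 eU] : nbhs x U by exact: open_nbhs_nbhs.
  have lo i : exists q : rat, x 0 i - e < ratr q < x 0 i.
    have [q] := rat_in_itvoo (ltac:(lra) : x 0 i - e < x 0 i).
    by rewrite in_itv; exists q.
  have hi i : exists q : rat, x 0 i < ratr q < x 0 i + e.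
    have [q] := rat_in_itvoo (ltac:(lra) : x 0 i < x 0 i + e).
    by rewrite in_itv; exists q.
  have [p pE] := choice lo; have [q qE] := choice hi.
  exists (\row_i p i, \row_i q i) => //; case: pselect => /= [?|[]].
    move=> i /=; rewrite !mxE.
    by have /andP[_ ->] := pE i; have /andP[/ltW ->] := qE i.
  apply: subset_trans eU => y xy; split => // i j; rewrite !(ord1 i).
  have := xy j; rewrite /= !mxE => /andP[py yq].
  have /andP[xp _] := pE j; have /andP[_ qx] := qE j.
  by rewrite /ball/= ltr_norml; apply/andP; split; lra.
apply: countable_bigcupT_measurable => // pq.
by case: pselect => ?; [exact: box_measurable|exact: measurable0].
Qed.

Lemma closed_lebesgue_measurable K : closed K -> measurable (K : set VL).
Proof.
by rewrite -openC => /open_lebesgue_measurable /measurableC; rewrite setCK.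
Qed.

Lemma lebesgue_outer_box ab : (outer (box ab) < +oo)%E.
Proof.
apply: (@le_lt_trans _ _ (box_volume ab)%:E); last by rewrite ltry.
pose F (k : nat) : V * V := if k is 0%N then ab else (0, 0).
have vol0 : box_volume ((0, 0) : V * V) = 0.
  by rewrite /box_volume big_ord_recl/= !mxE subrr maxxx mul0r.
apply: (@le_trans _ _ (\sum_(k <oo) (box_volume (F k))%:E)%E).
  by apply: lebesgue_outer_cover => x xab; exists 0%N.
rewrite (@nneseries_recl _ xpredT)//.
  by rewrite eseries0 ?adde0// => -[|k] //= _ _; rewrite vol0.
by move=> k _; rewrite lee_fin box_volume_ge0.
Qed.

End lebesgue_sets.

(** * Finiteness and closedness of bodies *)

Section bodies.
Context {R : realType} {n : nat}.
Local Notation V := 'rV[R]_n.+1.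
Local Notation outer := (@lebesgue_outer R n).
Local Notation VL := (caratheodory_type outer).
Local Notation mu := (lebesgue_rV R n).
Implicit Types (A K L U : set V) (f g h : V -> R) (x y u v z : V).

Lemma bounded_outer A (c : 'I_n.+1 -> R) :
  (forall x i, A x -> `|x 0 i| <= c i) -> (outer A < +oo)%E.
Proof.
(* Boxes are open on the left, hence the slack of 1. *)
move=> Ac; apply: le_lt_trans (lebesgue_outer_box (\row_i (- c i - 1), \row_i c i)).
apply: le_lebesgue_outer => x /Ac xc i; rewrite /= !mxE.
have := xc i; rewrite ler_norml => /andP[? ->]; rewrite andbT; lra.
Qed.

Lemma integrable_indic_rV A : closed A -> (outer A < +oo)%E ->
  integrable_rV (\1_A : V -> R).
Proof.
move=> cA Afin; have mA := closed_lebesgue_measurable cA.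
apply/integrableP; split; first exact/measurable_EFinP/measurable_indic.
rewrite (eq_integral (fun x : VL => (\1_A x)%:E)); last first.
  by move=> x _ /=; rewrite ger0_norm.
by rewrite integral_indic// setIT.
Qed.

Lemma integral_indic_rV A : closed A -> integral_rV (\1_A : V -> R) = mu A.
Proof.
move=> cA; have mA := closed_lebesgue_measurable cA.
by rewrite /integral_rV integral_indic// setIT.
Qed.

Lemma convex_body_closed K : convex_body K -> closed K.
Proof. by case=> cK _ _; exact: (compact_closed (@norm_hausdorff _ _)). Qed.

Lemma convex_body_fin K : convex_body K -> (outer K < +oo)%E.
Proof.
case=> /compact_bounded[M [_ HM]] _ _.
apply: (@bounded_outer _ (fun=> M + 1)) => x i Kx.
have := HM (M + 1); rewrite ltrDl ltr01 => /(_ isT x Kx) /=.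
apply: le_trans; rewrite [leRHS]mx_normrE.
exact: (le_bigmax _ (fun ij => `|x ij.1 ij.2|) (0, i)).
Qed.

Lemma dotv_continuous (theta : V) : continuous (dotv ^~ theta).
Proof.
apply: continuous_big; first exact: add_continuous.
by move=> i _ x; apply: continuousM; [exact: coord_continuous|exact: cst_continuous].
Qed.

Lemma log_comb_closed (t : R) K L : closed (log_comb t K L).
Proof.
apply: closed_bigI => theta _.
rewrite (_ : [set x | _] =
  dotv^~ theta @^-1` [set y | y <= gmean t (support_function K theta)
                                   (support_function L theta)])//.
have /continuous_closedP := @dotv_continuous theta.
by apply; exact: closed_le.
Qed.

(** The constraints for the directions +-e_i already bound every coordinate,
    whatever the values of the support functions are. *)
Lemma log_comb_fin (t : R) K L : (outer (log_comb t K L) < +oo)%E.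
Proof.
pose e (i : 'I_n.+1) : V := delta_mx 0 i.
have dote x i : dotv x (e i) = x 0 i.
  rewrite /dotv (bigD1 i)//= big1 ?addr0 ?mxE ?eqxx ?mulr1// => j ji.
  by rewrite mxE (negbTE ji) andbF mulr0.
have dotNe x i : dotv x (- e i) = - x 0 i.
  rewrite -dote /dotv -sumrN; apply: eq_bigr => j _.
  by rewrite mxE mulrN.
have Se i : sphere (e i) by rewrite /sphere/= dote mxE !eqxx.
have SNe i : sphere (- e i) by rewrite /sphere/= dotNe !mxE !eqxx opprK.
pose b theta := gmean t (support_function K theta) (support_function L theta).
apply: (@bounded_outer _ (fun i => Num.max (b (e i)) (b (- e i)))) => x i xKL.
have := xKL _ (Se i); have := xKL _ (SNe i); rewrite /= dote dotNe -/(b _) => h1 h2.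
rewrite ler_norml lerNl; apply/andP; split; rewrite le_max; apply/orP;
  [right; exact: h1|left; exact: h2].
Qed.

End bodies.

(** * The two implications *)

Section directions.
Context {R : realType} {n : nat}.
Local Notation V := 'rV[R]_n.+1.
Local Notation outer := (@lebesgue_outer R n).
Local Notation VL := (caratheodory_type outer).
Local Notation mu := (lebesgue_rV R n).
Implicit Types (A K L U : set V) (f g h : V -> R) (x y u v z : V) (t : R).

Lemma gmeanE t (a b : R) : 0 < a -> 0 < b -> gmean t a b = geom t a b.
Proof. by move=> a0 b0; rewrite /gmean mulf_eq0 !gt_eqF. Qed.

Lemma gmeaneE t (a b : R) : 0 < a -> 0 < b ->
  gmeane t a%:E b%:E = (geom t a b)%:E.
Proof. by move=> a0 b0; rewrite /gmeane -EFinM eqe mulf_eq0 !gt_eqF. Qed.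

Lemma superlevel_indic K (s : R) : superlevel (\1_K : V -> R) s =
  if s <= 0 then setT else if s <= 1 then K else set0.
Proof.
rewrite /superlevel; apply/seteqP; split => x /=; rewrite indicE.
  have [xK|xK] := boolP (x \in K); rewrite /=.
    by case: ifPn => // _ ->; rewrite -inE.
  by move=> ->.
case: ifPn => [s0 _|_]; first by rewrite (le_trans s0).
by case: ifPn => // s1 Kx; rewrite mem_set.
Qed.

Lemma unimodal_indic K : convex_body K -> unimodal (\1_K : V -> R).
Proof.
move=> cK s; rewrite superlevel_indic.
by case: ifP => [//|_]; case: ifP => // _ [].
Qed.

Lemma even_indic K : origin_symmetric K -> even_fun (\1_K : V -> R).
Proof.
move=> sK x; rewrite !indicE; congr (_%:R); congr nat_of_bool.
by apply/idP/idP; rewrite !inE => /sK; rewrite ?opprK.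
Qed.

Lemma functional_to_geometric t :
  (forall f g h : V -> R,
     (forall x, 0 <= f x) -> (forall x, 0 <= g x) -> (forall x, 0 <= h x) ->
     integrable_rV f -> integrable_rV g -> integrable_rV h ->
     even_fun f -> unimodal f -> even_fun g -> unimodal g ->
     (forall z u v, Cset t z f g (u, v) -> gmean t (f u) (g v) <= h z) ->
     (gmeane t (integral_rV f) (integral_rV g) <= integral_rV h)%E) ->
  forall K L : set V,
     convex_body K -> origin_symmetric K ->
     convex_body L -> origin_symmetric L ->
     (gmeane t (mu K) (mu L) <= mu (log_comb t K L))%E.
Proof.
move=> Hfun K L cK sK cL sL.
have KC := convex_body_closed cK; have LC := convex_body_closed cL.
have KLC := @log_comb_closed R n t K L.
rewrite -!integral_indic_rV//; apply: Hfun => //.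
- exact: integrable_indic_rV KC (convex_body_fin cK).
- exact: integrable_indic_rV LC (convex_body_fin cL).
- exact: integrable_indic_rV KLC (log_comb_fin _ _ _).
- exact: even_indic.
- exact: unimodal_indic.
- exact: even_indic.
- exact: unimodal_indic.
move=> z u v; rewrite /Cset/= !superlevel_indic !indicE.
have [uK|_] := boolP (u \in K); last by rewrite /gmean mul0r eqxx.
have [vL|_] := boolP (v \in L); last by rewrite /gmean mulr0 eqxx.
rewrite ler10 lexx => zKL; rewrite mem_set//.
by rewrite gmeanE// /geom !powR1 mulr1.
Qed.

(** The alternative to a convex body is the whole space, whose measure would be
    a positive real number by the hypotheses on the tail of f, against
    [lebesgue_outerT]. *)
Lemma superlevel_convex_body f u : (forall x, 0 <= f x) ->
  integrable_rV f -> unimodal f -> 0 < f u -> 0 < tail mu f (f u) ->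
  convex_body (superlevel f (f u)).
Proof.
move=> f0 If uf fu tu; apply: uf => [|fT]; first by exists u; exact: lexx.
have : (tail mu f (f u))%:E = outer setT.
  by rewrite -(@tailE _ VL R mu f f0 If _ fu) -fT.
move=> TE; case: (@lebesgue_outerT R n) => oT; rewrite oT in TE.
  by case: TE => TE; rewrite TE ltxx in tu.
by [].
Qed.

Lemma superlevel_symmetric f (s : R) : even_fun f -> origin_symmetric (superlevel f s).
Proof. by move=> ef x; rewrite /superlevel/= ef. Qed.

Lemma geometric_to_functional t : 0 <= t <= 1 ->
  (forall K L : set V,
     convex_body K -> origin_symmetric K ->
     convex_body L -> origin_symmetric L ->
     (gmeane t (mu K) (mu L) <= mu (log_comb t K L))%E) ->
  forall f g h : V -> R,
     (forall x, 0 <= f x) -> (forall x, 0 <= g x) -> (forall x, 0 <= h x) ->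
     integrable_rV f -> integrable_rV g -> integrable_rV h ->
     even_fun f -> unimodal f -> even_fun g -> unimodal g ->
     (forall z u v, Cset t z f g (u, v) -> gmean t (f u) (g v) <= h z) ->
     (gmeane t (integral_rV f) (integral_rV g) <= integral_rV h)%E.
Proof.
move=> t01 Hgeom f g h f0 g0 h0 If Ig Ih ef uf eg ug hfg.
have intE (k : V -> R) : integrable_rV k ->
    integral_rV k = (fine (integral_rV k))%:E :> \bar R.
  by move=> Ik; rewrite fineK//; exact: integrable_fin_num.
have int0 (k : V -> R) : (forall x, 0 <= k x) -> (0 <= integral_rV k)%E.
  by move=> k0; apply: integral_ge0 => x _; rewrite lee_fin.
have [fg0|] := eqVneq (integral_rV f * integral_rV g)%E 0%E.
  by rewrite /gmeane fg0 eqxx int0.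
rewrite mule_eq0 negb_or => /andP[fn0 gn0].
have fp : (0 < integral_rV f)%E by rewrite lt_neqAle eq_sym fn0 int0.
have gp : (0 < integral_rV g)%E by rewrite lt_neqAle eq_sym gn0 int0.
rewrite (intE f)// (intE g)// (intE h)// gmeaneE; last 2 first.
- by rewrite -lte_fin -intE.
- by rewrite -lte_fin -intE.
rewrite lee_fin; apply: (@prekopa_leindler_tails _ VL R mu t f g h t01) => // s r s0 r0 fs gr.
(* The levels s and r need not be values of f and g, so they are replaced by
   values f u >= s and g v >= r at which the tails have hardly decreased. *)
apply: le_of_scaled => [|c /andP[c0 c1]]; first exact: geom_gt0.
rewrite -(geomZ _ c0 (ltW fs) (ltW gr)).
have [|u su cu] := @tail_attained _ VL R mu f f0 If s (c * tail mu f s) s0.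
  by rewrite mulr_ge0 ?tail_ge0 ?(ltW c0)//= gtr_pMl.
have [|v rv cv] := @tail_attained _ VL R mu g g0 Ig r (c * tail mu g r) r0.
  by rewrite mulr_ge0 ?tail_ge0 ?(ltW c0)//= gtr_pMl.
have fu0 := lt_le_trans s0 su; have gv0 := lt_le_trans r0 rv.
have tu0 : 0 < tail mu f (f u) by rewrite (lt_trans _ cu)// mulr_gt0.
have tv0 : 0 < tail mu g (g v) by rewrite (lt_trans _ cv)// mulr_gt0.
apply: (@le_trans _ _ (geom t (tail mu f (f u)) (tail mu g (g v)))).
  by apply: le_geom => //; rewrite ?(ltW cu) ?(ltW cv)// mulr_ge0// ltW.
rewrite -lee_fin -(@tailE _ VL R mu h h0 Ih _ (geom_gt0 t s0 r0)) -gmeaneE//.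
rewrite -(@tailE _ VL R mu f f0 If _ fu0) -(@tailE _ VL R mu g g0 Ig _ gv0).
apply: le_trans (Hgeom _ _ (superlevel_convex_body f0 If uf fu0 tu0)
  (@superlevel_symmetric _ _ ef) (superlevel_convex_body g0 Ig ug gv0 tv0)
  (@superlevel_symmetric _ _ eg)) _.
apply: le_lebesgue_outer => z zfg /=; apply: le_trans (hfg z u v zfg).
by rewrite gmeanE// le_geom// ltW.
Qed.

End directions.

Unset Implicit Arguments.

Theorem theorem1p3 (R : realType) (n : nat) (t : R) (ht : 0 <= t <= 1) :
  (forall K L : set 'rV[R]_n.+1,
     convex_body K -> origin_symmetric K ->
     convex_body L -> origin_symmetric L ->
     (gmeane t (lebesgue_rV R n K) (lebesgue_rV R n L) <=
      lebesgue_rV R n (log_comb t K L))%E)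
  <->
  (forall f g h : 'rV[R]_n.+1 -> R,
     (forall x, 0 <= f x) -> (forall x, 0 <= g x) -> (forall x, 0 <= h x) ->
     integrable_rV f -> integrable_rV g -> integrable_rV h ->
     even_fun f -> unimodal f -> even_fun g -> unimodal g ->
     (forall z u v, Cset t z f g (u, v) -> gmean t (f u) (g v) <= h z) ->
     (gmeane t (integral_rV f) (integral_rV g) <=
      integral_rV h)%E).
Proof.
split; [exact: geometric_to_functional|exact: functional_to_geometric].
Qed.
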